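(* Let $\mathbf{G}=(G,\alpha,w)$ and $\mathbf{G}'=(G',\alpha',w')$ be finite MW-graphs. Then $$\mathbf{G}\sqsubseteq\mathbf{G}'\quad\text{implies}\quad \mathbf{G}\preccurlyeq\mathbf{G}'.$$ Moreover, if there is an MW-homomorphism $\pi\colon\mathbf{G}\to\mathbf{G}'$ which is (vertex and edge) measure preserving, then additionally $$\mathbf{G}'\stackrel{r}{\preccurlyeq}\mathbf{G},\qquad\text{where } r=|\mathbf{G}|-|\mathbf{G}'|\ge 0.$$
   Context: Graphs: a graph $G=(V,E,\partial)$ consists of disjoint, at most countable sets $V$ (vertices) and $E$ (edges), a map $\partial\colon E\to V\times V$, $\partial e=(\partial_-e,\partial_+e)$ (initial and terminal vertex), and an involution $e\mapsto\bar e$ on $E$ with $e\neq\bar e$ and $\partial_\pm\bar e=\partial_\mp e$. Loops and multiple edges are allowed; $G$ need not be connected. $E_v=\{e\in E:\partial_-e=v\}$, $\deg(v)=|E_v|<\infty$. MW-graphs: a weight $w$ on $G$ is a pair of functions $w\colon V\to(0,\infty)$, $w\colon E\to(0,\infty)$ with $w_{\bar e}=w_e$. Fix a subgroup $R$ of $\mathbb{R}/2\pi\mathbb{Z}$ (written additively). A magnetic potential is a map $\alpha\colon E\to R$ with $\alpha_{\bar e}=-\alpha_e$. A magnetic weighted graph (MW-graph) is $\mathbf{G}=(G,\alpha,w)$; it is finite if $V$ is finite, and $|\mathbf{G}|=|V|$. MW-homomorphisms: a graph homomorphism $\pi\colon G\to G'$ consists of maps $\pi\colon V\to V'$, $\pi\colon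 E\to E'$ with $\pi(\partial_\pm e)=\partial'_\pm(\pi e)$. An MW-homomorphism $\pi\colon\mathbf{G}\to\mathbf{G}'$ is a graph homomorphism with $\alpha_e=\alpha'_{\pi e}$ for all $e\in E$, $(\pi_*w)(v'):=\sum_{v\in V,\pi(v)=v'}w(v)\ge w'(v')$ for all $v'\in V'$, and $(\pi_*w)_{e'}:=\sum_{e\in E,\pi(e)=e'}w_e\le w'_{e'}$ for all $e'\in E'$. It is vertex (resp. edge) measure preserving if equality holds in the vertex (resp. edge) weight condition for all $v'$ (resp. all $e'$). Write $\mathbf{G}\sqsubseteq\mathbf{G}'$ if there is an MW-homomorphism $\mathbf{G}\to\mathbf{G}'$. Spectral preorder: the magnetic Laplacian of a finite MW-graph is the self-adjoint non-negative operator on $\ell_2(V,w)$ (inner product $\sum_v w(v)\varphi(v)\overline{\psi(v)}$) given by $(\Delta_\alpha\varphi)(v)=\frac1{w(v)}\sum_{e\in E_v}w_e\bigl(\varphi(v)-\mathrm{e}^{\mathrm{i}\alpha_e}\varphi(\partial_+e)\bigr)$. Its eigenvalues are $\lambda_1(\mathbf{G})\le\dots\le\lambda_{|\mathbf{G}|}(\mathbf{G})$, repeated by multiplicity. For $r\in\mathbb{N}_0$, $\mathbf{G}\stackrel{r}{\preccurlyeq}\mathbf{G}'$ means $|\mathbf{G}|\ge|\mathbf{G}'|-r$ and $\lambda_k(\mathbf{G})\le\lambda_{k+r}(\mathbf{G}')$ for all $1\le k\le|\mathbf{G}'|-r$; $\preccurlyeq$ means $\stackrel{0}{\preccurlyeq}$.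 *)

(* Defs.v *)
From HB Require Import structures.
From mathcomp Require Import all_boot all_order all_algebra generic_quotient.
From mathcomp Require Import complex ring.
From mathcomp Require Import reals trigo.

Set Implicit Arguments.
Unset Strict Implicit.
Unset Printing Implicit Defensive.

Import Order.TTheory GRing.Theory Num.Theory.
Local Open Scope ring_scope.
Local Open Scope complex_scope.
Local Open Scope quotient_scope.

Definition twopiZ (R : realType) : {pred R} :=
  [pred x | x / (pi *+ 2) \is a Num.int].

Arguments twopiZ R : clear implicits.

Fact twopiZ_zmod_closed (R : realType) : zmod_closed (twopiZ R).
Proof.
split=> [|x y]; rewrite !inE ?mul0r ?rpred0 // => xZ yZ.
by rewrite mulrBl rpredB.
Qed.

HB.instance Definition _ (R : realType) :=
  GRing.isZmodClosed.Build R (twopiZ R) (twopiZ_zmod_closed R).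

Definition angle (R : realType) := Quotient.quot (twopiZ R).

(* e^{ia}; the choice of representative is irrelevant, see [expi_pi]. *)
Definition expi (R : realType) (a : angle R) : R[i] :=
  cos (repr a) +i* sin (repr a).

Lemma expi_pi (R : realType) (x : R) :
  expi (\pi_(angle R) x) = cos x +i* sin x.
Proof.
rewrite /expi; set y := repr _.
have : (y - x) \in twopiZ R.
  by rewrite Quotient.idealrBE; apply/eqP; rewrite reprK.
have pi2_neq0 : pi *+ 2 != 0 :> R by rewrite mulrn_eq0 /= gt_eqF ?pi_gt0.
rewrite inE => /intrP[m /(canRL (divfK pi2_neq0)) yx].
have -> : y = x + (pi *+ 2) *~ m by rewrite -mulrzl -yx addrC subrK.
have shift n (u : R) :
    cos (u + pi *+ 2 *+ n) = cos u /\ sin (u + pi *+ 2 *+ n) = sin u.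
  elim: n => [|n [IHc IHs]]; first by rewrite addr0.
  by rewrite mulrSr addrA cosD2pi sinD2pi IHc IHs.
case: m {yx} => n; first by rewrite !(shift n x).1 !(shift n x).2.
have [] := shift n.+1 (x - pi *+ 2 *+ n.+1); rewrite subrK => -> ->.
by rewrite NegzE mulrNz.
Qed.

Lemma expiN (R : realType) (a : angle R) : expi (- a) = ((expi a)^*)%R.
Proof.
have -> : - a = \pi_(angle R) (- repr a).
  by rewrite -[LHS]/(Quotient.opp a) -[in LHS](reprK a) Quotient.pi_opp.
rewrite -[in RHS](reprK a).
by rewrite !expi_pi cosN sinN.
Qed.

Lemma expi_conj (R : realType) (a : angle R) : (expi a)^* * expi a = 1.
Proof.
rewrite /expi; simpc.
by rewrite -!expr2 cos2Dsin2 mulrC subrr.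
Qed.

(* Finite graphs: as all degrees are finite, finitely many vertices force
   finitely many edges, so both types are finite. Loops and multiple edges are
   allowed, and the graph may be empty or disconnected. *)

Record graph := Graph {
  vertex : finType;
  edge : finType;
  bd : edge -> vertex * vertex;
  inv : edge -> edge;
  invK : involutive inv;
  inv_neq : forall e, inv e != e;
  bd_inv : forall e, bd (inv e) = ((bd e).2, (bd e).1)
}.

Definition src (G : graph) (e : edge G) : vertex G := (bd e).1.
Definition tgt (G : graph) (e : edge G) : vertex G := (bd e).2.

(* Only endpoints are preserved; compatibility with [inv] is not required. *)
Record graph_hom (G G' : graph) := GraphHom {
  homv : vertex G -> vertex G';
  home : edge G -> edge G';
  hom_src : forall e, homv (src e) = src (home e);
  hom_tgt : forall e, homv (tgt e) = tgt (home e)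
}.

(* The subgroup A of R/2piZ in which potentials take their values is fixed. *)

Record mwgraph (R : realType) (A : zmodClosed (angle R)) := MWGraph {
  mwg :> graph;
  alpha : edge mwg -> angle R;
  alpha_in : forall e, alpha e \in A;
  alpha_inv : forall e, alpha (inv e) = - alpha e;
  wv : vertex mwg -> R;
  wv_gt0 : forall v, 0 < wv v;
  we : edge mwg -> R;
  we_gt0 : forall e, 0 < we e;
  we_inv : forall e, we (inv e) = we e
}.

Section MWHom.
Variables (R : realType) (A : zmodClosed (angle R)) (G G' : mwgraph A).
Implicit Type p : graph_hom G G'.

Definition pushv p (v' : vertex G') : R := \sum_(v | homv p v == v') wv v.
Definition pushe p (e' : edge G') : R := \sum_(e | home p e == e') we e.

Definition mw_hom p : Prop :=
  [/\ forall e, alpha e = alpha (home p e),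
      forall v', wv v' <= pushv p v' &
      forall e', pushe p e' <= we e'].

Definition vertex_measure_preserving p : Prop :=
  forall v', pushv p v' = wv v'.
Definition edge_measure_preserving p : Prop :=
  forall e', pushe p e' = we e'.

Definition mw_le : Prop := exists p : graph_hom G G', mw_hom p.

End MWHom.

Section Laplacian.
Variables (R : realType) (A : zmodClosed (angle R)) (G : mwgraph A).
Implicit Types phi psi : vertex G -> R[i].

Definition inner phi psi : R[i] :=
  \sum_v (wv v)%:C * phi v * (psi v)^*.

Definition laplacian phi (v : vertex G) : R[i] :=
  ((wv v)^-1)%:C *
  \sum_(e | src e == v) (we e)%:C * (phi v - expi (alpha e) * phi (tgt e)).

(* Matrix in the basis of indicator functions, acting on column vectors. *)
Definition laplacian_mx : 'M[R[i]]_#|vertex G| :=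
  \matrix_(i, j)
    laplacian (fun v => (v == enum_val j)%:R) (enum_val i).

Lemma laplacian_mxE phi :
  laplacian_mx *m (\col_j phi (enum_val j)) =
  \col_i laplacian phi (enum_val i).
Proof.
apply/colP => i; rewrite !mxE.
under eq_bigr do rewrite !mxE /laplacian -mulrA.
rewrite -mulr_sumr; congr (_ * _).
under eq_bigr do rewrite mulr_suml.
rewrite exchange_big /=; apply: eq_bigr => e _.
under eq_bigr do rewrite -mulrA.
rewrite -mulr_sumr; congr (_ * _).
have sumE v : \sum_(j < #|vertex G|)
    (v == enum_val j)%:R * phi (enum_val j) = phi v.
  rewrite (bigD1 (enum_rank v)) //= enum_rankK eqxx mul1r.
  rewrite big1 ?addr0 // => j jv; case: eqP => [vj|_]; last by rewrite mul0r.
  by rewrite vj enum_valK eqxx in jv.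
under eq_bigr do rewrite mulrBl -mulrA.
by rewrite sumrB -mulr_sumr !sumE.
Qed.

(* The Dirichlet form; each edge is counted in both orientations. *)
Definition dirichlet phi psi : R[i] :=
  2^-1 * \sum_e (we e)%:C * (phi (src e) - expi (alpha e) * phi (tgt e)) *
                 (psi (src e) - expi (alpha e) * psi (tgt e))^*.

Lemma inner_laplacian phi psi :
  inner (laplacian phi) psi = dirichlet phi psi.
Proof.
have innerE : inner (laplacian phi) psi = \sum_e
    (we e)%:C * (phi (src e) - expi (alpha e) * phi (tgt e)) * (psi (src e))^*.
  rewrite [RHS](partition_big (@src G) predT) //=; apply: eq_bigr => v _.
  rewrite /laplacian mulrA -rmorphM /= mulfV ?gt_eqF ?wv_gt0 // mul1r.
  rewrite mulr_suml; apply: eq_bigr => e /eqP <-.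
  by [].
have src_inv e : src (inv e) = tgt e by rewrite /src bd_inv.
have tgt_inv e : tgt (inv e) = src e by rewrite /tgt bd_inv.
have innerE' : inner (laplacian phi) psi = - \sum_e
    (we e)%:C * (phi (src e) - expi (alpha e) * phi (tgt e)) *
    (expi (alpha e) * psi (tgt e))^*.
  rewrite innerE (reindex_inj (inv_inj (@invK G))) -sumrN.
  apply: eq_bigr => e _.
  rewrite src_inv tgt_inv we_inv alpha_inv expiN.
  rewrite (_ : ((expi _ * _)^*)%R = (expi (alpha e))^* * (psi (tgt e))^*); last first.
    exact: rmorphM.
  have := expi_conj (alpha e); move: (expi _) => z zz.
  rewrite -[in LHS](mul1r (phi (tgt e))) -zz.
  ring.
rewrite /dirichlet; under eq_bigr do rewrite rmorphB mulrBr.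
rewrite sumrB -innerE.
rewrite -[X in _ - X]opprK -innerE' opprK -mulr2n.
by rewrite -[inner _ _ *+ 2]mulr_natl mulKf // pnatr_eq0.
Qed.

Lemma laplacian_selfadjoint phi psi :
  inner (laplacian phi) psi = inner phi (laplacian psi).
Proof.
have conjr (x : R) : ((x%:C)^*)%R = x%:C by exact: conjc_real.
have conjM (x y : R[i]) : ((x * y)^*)%R = x^* * y^* by exact: rmorphM.
have conjS (I : finType) (F : I -> R[i]) :
  ((\sum_i F i)^*)%R = \sum_i (F i)^* by exact: rmorph_sum.
have innerC u v : inner u v = ((inner v u)^*)%R.
  rewrite /inner conjS; apply: eq_bigr => x _.
  by rewrite !conjM conjCK conjr mulrAC.
rewrite [RHS]innerC !inner_laplacian /dirichlet conjM conjS.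
congr (_ * _); first by rewrite fmorphV rmorph_nat.
by apply: eq_bigr => e _; rewrite !conjM conjCK conjr mulrAC.
Qed.

Lemma laplacian_nonneg phi : 0 <= inner (laplacian phi) phi.
Proof.
rewrite inner_laplacian mulr_ge0 ?invr_ge0 ?ler0n // sumr_ge0 // => e _.
by rewrite -mulrA mulr_ge0 ?mul_conjC_ge0 // ler0c ltW ?we_gt0.
Qed.

Definition laplacian_roots : seq R[i] :=
  sval (closed_field_poly_normal (char_poly laplacian_mx)).

Lemma laplacian_rootsE :
  char_poly laplacian_mx = \prod_(z <- laplacian_roots) ('X - z%:P).
Proof.
rewrite /laplacian_roots; case: closed_field_poly_normal => s /= {1}->.
by rewrite (monicP (char_poly_monic _)) scale1r.
Qed.

Lemma size_laplacian_roots : size laplacian_roots = #|vertex G|.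
Proof.
apply: succn_inj; rewrite -(size_prod_XsubC _ id) -laplacian_rootsE.
exact: size_char_poly.
Qed.

Lemma laplacian_roots_ge0 z : z \in laplacian_roots -> 0 <= z.
Proof.
rewrite -root_prod_XsubC -laplacian_rootsE.
have -> : char_poly laplacian_mx = char_poly laplacian_mx^T.
  rewrite /char_poly -[LHS]det_tr; congr (\det _).
  by rewrite /char_poly_mx linearB /= tr_scalar_mx map_trmx.
rewrite -eigenvalue_root_char => /eigenvalueP[u uz u0].
pose phi v := u 0 (enum_rank v).
have u_phi : u^T = \col_j phi (enum_val j).
  by apply/colP => j; rewrite !mxE /phi enum_valK.
have Lphi v : laplacian phi v = z * phi v.
  have /colP/(_ (enum_rank v)) := laplacian_mxE phi.
  by rewrite -u_phi -[_ *m _]trmxK trmx_mul trmxK uz !mxE enum_rankK.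
have innerz : inner (laplacian phi) phi = z * inner phi phi.
  rewrite /inner mulr_sumr; apply: eq_bigr => v _.
  by rewrite Lphi mulrCA !mulrA.
have inner_ge0 v : 0 <= (wv v)%:C * phi v * (phi v)^*.
  by rewrite -mulrA mulr_ge0 ?mul_conjC_ge0 // ler0c ltW ?wv_gt0.
have inner_gt0 : 0 < inner phi phi.
  rewrite lt_def sumr_ge0 // andbT; apply: contra u0 => /eqP i0.
  apply/eqP/rowP => j; rewrite mxE -[j]enum_valK -/(phi _).
  have /eqP := psumr_eq0P (fun v _ => inner_ge0 v) i0 (i := enum_val j) isT.
  rewrite -mulrA mulf_eq0 mul_conjC_eq0 => /orP[|/eqP//].
  by rewrite eq_complex /= eqxx andbT gt_eqF ?wv_gt0.
by have := laplacian_nonneg phi; rewrite innerz pmulr_lge0.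
Qed.

(* The eigenvalues with multiplicity, in increasing order. Taking real parts
   loses nothing by [laplacian_roots_ge0]; algebraic and geometric
   multiplicities agree by [laplacian_selfadjoint]. *)
Definition spectrum : seq R :=
  sort <=%R [seq complex.Re z | z <- laplacian_roots].

(* Numbered from 1, meaningful for 1 <= k <= #|vertex G|. *)
Definition lambda (k : nat) : R := nth 0 spectrum k.-1.

End Laplacian.

Definition spectral_le (R : realType) (A : zmodClosed (angle R)) (r : nat)
    (G G' : mwgraph A) : Prop :=
  (#|vertex G'| - r <= #|vertex G|)%N /\
  forall k : nat, (1 <= k <= #|vertex G'| - r)%N ->
    lambda G k <= lambda G' (k + r).

(* Main.v *)
Require Import Defs.
From mathcomp Require Import all_boot all_order all_algebra all_fingroup.
From mathcomp Require Import complex ring.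
From mathcomp Require Import reals.

(** Pulling functions back along a homomorphism [p : G -> G'] compares the two
    Rayleigh quotients.  Grouping vertices and edges by their images shows that
    the squared norm of [phi \o homv p] is that of [phi] with the vertex weight
    of [G'] replaced by the push-forward of the weight of [G], and that its
    Dirichlet energy is that of [phi] with the edge weight replaced likewise
    ([inner_pullback], [dirichlet_pullback]; equality of the potentials is what
    makes the energies of an edge and of its image agree).  Hence pulling back
    does not decrease the norm and does not increase the energy, and when [p]
    is measure preserving it keeps both.

    The rest is the Courant-Fischer principle, used through a single dimension
    count.  The Laplacian, being self-adjoint for the weighted inner product,
    has coordinates in which the norm is the sum of the [|c_i|^2] and the
    energy the sum of the [lambda_i |c_i|^2] ([spectral_coordinates]).  If the
    sizes of a set [S'] of eigenvalue indices of [G'] and of a set [S] of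
    eigenvalue indices of [G] add up to more than the number of vertices of
    [G], a homogeneous linear system with fewer equations than unknowns yields
    a nonzero function on [G'] made of eigenfunctions in [S'] whose pullback is
    made of eigenfunctions in [S] ([exists_in_windows]).

    For the first claim, [S'] holds the [k] lowest eigenvalues of [G'] and [S]
    those of [G] from the [k]-th on, so that, with [f] the resulting function,
    [lambda_k(G) |f|^2 <= lambda_k(G) |f \o p|^2 <= E(f \o p) <= E'(f)
    <= lambda_k(G') |f|^2].
    For the second, the roles of low and high are exchanged: [S'] holds the
    eigenvalues of [G'] from the [k]-th on and [S] the [k + r] lowest of [G],
    and [lambda_k(G') |f|^2 <= E'(f) = E(f \o p) <= lambda_(k+r)(G) |f|^2]. *)

Set Implicit Arguments.
Unset Strict Implicit.
Unset Printing Implicit Defensive.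

Import Order.TTheory GRing.Theory Num.Theory.
Local Open Scope ring_scope.
Local Open Scope complex_scope.
Local Open Scope sesquilinear_scope.

(** * Linear algebra and counting *)

Lemma char_poly_diagonalizable (F : fieldType) n (Q : 'M[F]_n) (d : 'rV[F]_n) :
  Q \in unitmx ->
  char_poly (invmx Q *m diag_mx d *m Q) = \prod_(i < n) ('X - (d 0 i)%:P).
Proof.
move=> uQ; have detQ : \det (invmx Q) * \det Q = 1.
  by rewrite -det_mulmx mulVmx // det1.
have -> : char_poly (invmx Q *m diag_mx d *m Q) = char_poly (diag_mx d).
  rewrite /char_poly.
  have -> : char_poly_mx (invmx Q *m diag_mx d *m Q) =
      map_mx polyC (invmx Q) *m char_poly_mx (diag_mx d) *m map_mx polyC Q.
    rewrite /char_poly_mx mulmxBr mulmxBl !map_mxM /=; congr (_ - _).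
    by rewrite mul_mx_scalar -scalemxAl -map_mxM mulVmx // map_mx1 scalemx1.
  by rewrite !det_mulmx !det_map_mx mulrAC -rmorphM /= detQ mul1r.
rewrite char_poly_trig ?diag_mx_is_trig //.
by apply: eq_bigr => i _; rewrite mxE eqxx mulr1n.
Qed.

(** A homogeneous linear system with fewer equations (the rows in [T]) than
    unknowns (the entries in [S]) has a nonzero solution. *)
Lemma exists_supported_kernel (F : fieldType) m n (M : 'M[F]_(n, m))
    (S : pred 'I_m) (T : pred 'I_n) : (#|T| < #|S|)%N ->
  exists c : 'cV[F]_m, [/\ c != 0, forall i, ~~ S i -> c i 0 = 0 &
    forall j, T j -> (M *m c) j 0 = 0].
Proof.
move=> ltTS.
(* [E] extends a vector indexed by [S] by zero. *)
pose E : 'M[F]_(m, #|S|) := \matrix_(i, k) (enum_val k == i)%:R.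
pose N : 'M[F]_(#|T|, #|S|) := rowsub enum_val (M *m E).
have : kermx N^T != 0.
  rewrite kermx_eq0 /row_free mxrank_tr ltn_eqF //.
  exact: leq_ltn_trans (rank_leq_row N) ltTS.
case/rowV0Pn => u /sub_kermxP uN u0.
have Eu k : (E *m u^T) (enum_val k) 0 = u 0 k.
  rewrite mxE (bigD1 k) //= !mxE eqxx mul1r big1 ?addr0 // => l lk.
  by rewrite mxE (inj_eq enum_val_inj) (negPf lk) mul0r.
exists (E *m u^T); split.
- apply: contraNneq u0 => E0; apply/eqP/rowP => k.
  by rewrite -Eu E0 !mxE.
- move=> i Si; rewrite mxE big1 // => k _; rewrite mxE.
  case: eqP => [ki|_]; last by rewrite mul0r.
  by move: (enum_valP k); rewrite ki unfold_in (negPf Si).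
- move=> j Tj; have /matrixP/(_ 0 (enum_rank_in Tj j)) := uN.
  rewrite -[u *m _]trmxK trmx_mul trmxK mul_rowsub_mx -mulmxA !mxE.
  by rewrite enum_rankK_in.
Qed.

Lemma card_ord_lt n k : (k <= n)%N -> #|[pred i : 'I_n | (i < k)%N]| = k.
Proof.
move=> kn; rewrite -sum1_card -(big_ord_widen n (fun=> 1%N)) //.
by rewrite sum1_card card_ord.
Qed.

Lemma card_ord_ge n k : #|[pred i : 'I_n | (k <= i)%N]| = (n - k)%N.
Proof.
have [kn|nk] := leqP k n; last first.
  rewrite (eqP (ltnW nk : (n - k == 0)%N)); apply: eq_card0 => i.
  by rewrite !inE leqNgt (ltn_trans (ltn_ord i) nk).
have := cardC [pred i : 'I_n | (i < k)%N].
rewrite card_ord_lt // card_ord => cardE.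
apply: (@addnI k); rewrite subnKC // -[RHS]cardE; congr (_ + _)%N.
by apply: eq_card => i; rewrite !inE -leqNgt.
Qed.

(** * Spectral coordinates of a magnetic weighted graph *)

Section SpectralCoordinates.
Variables (R : realType) (A : zmodClosed (angle R)) (G : mwgraph A).
Implicit Types phi psi : vertex G -> R[i].
Local Notation n := #|vertex G|.

Definition vec phi : 'cV[R[i]]_n := \col_i phi (enum_val i).

Definition unvec (c : 'cV[R[i]]_n) (v : vertex G) : R[i] := c (enum_rank v) 0.

Lemma unvecK c : vec (unvec c) = c.
Proof. by apply/colP => i; rewrite mxE /unvec enum_valK. Qed.

Lemma inner_enum phi psi :
  inner phi psi = \sum_(i < n) (wv (enum_val i))%:C * vec phi i 0 *
                               (vec psi i 0)^*.
Proof.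
rewrite /inner (reindex_onto (@enum_val _ _) enum_rank) /=; last first.
  by move=> v _; rewrite enum_rankK.
by apply: eq_big => [i|i _]; rewrite ?enum_valK ?eqxx // !mxE.
Qed.

(** Self-adjointness for the weighted inner product, tested on indicator
    functions: it is the matrix product with the weights, not the matrix of the
    Laplacian, that is Hermitian. *)
Lemma laplacian_mx_balance i j :
  (wv (enum_val i))%:C * laplacian_mx G i j =
  (wv (enum_val j))%:C * ((laplacian_mx G j i)^*)%R.
Proof.
have /(_ (fun v => (v == enum_val j)%:R) (fun v => (v == enum_val i)%:R)) :=
  @laplacian_selfadjoint R A G.
rewrite /inner (bigD1 (enum_val i)) //= big1; last first.
  by move=> v /negPf ->; rewrite conjC0 mulr0.
rewrite (bigD1 (enum_val j)) //= big1; last first.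
  by move=> v /negPf ->; rewrite mulr0 mul0r.
by rewrite !eqxx conjC1 !addr0 !mulr1 !mxE.
Qed.

(** With [D] the diagonal matrix of the square roots of the vertex weights, [D]
    is an isometry from the weighted space to the standard Hermitian space, and
    it conjugates the Laplacian to a Hermitian matrix [S].  The spectral theorem
    gives a unitary [P] diagonalizing [S], and [Q = P D] is then both an
    isometry and a diagonalization. *)
Lemma laplacian_diagonalization :
  exists (Q : 'M[R[i]]_n) (d : 'rV[R[i]]_n),
    [/\ Q \in unitmx, laplacian_mx G = invmx Q *m diag_mx d *m Q &
     forall phi psi, inner phi psi =
       \sum_(i < n) (Q *m vec phi) i 0 * ((Q *m vec psi) i 0)^*].
Proof.
pose s (i : 'I_n) : R[i] := (Num.sqrt (wv (enum_val i)))%:C.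
have s0 i : s i != 0.
  by rewrite eq_complex /= eqxx andbT gt_eqF // sqrtr_gt0 wv_gt0.
have ss (i : 'I_n) : (wv (enum_val i))%:C = s i * s i.
  by rewrite -rmorphM -expr2 sqr_sqrtr // ltW ?wv_gt0.
have sJ i : ((s i)^*)%R = s i by exact: conjc_real.
pose D := diag_mx (\row_i s i).
have uD : D \in unitmx.
  by rewrite unitmxE det_diag unitfE; apply/prodf_neq0 => i _; rewrite mxE.
pose S : 'M[R[i]]_n := \matrix_(i, j) (s i * laplacian_mx G i j / s j).
have SD : S *m D = D *m laplacian_mx G.
  apply/matrixP => i j; rewrite mul_mx_diag mul_diag_mx.
  by rewrite !mxE divfK.
have hS : S \is hermsymmx.
  apply/is_hermitianmxP; rewrite expr0 scale1r.
  apply/matrixP => i j; rewrite mxE [in RHS]mxE [in RHS]mxE [in RHS]mxE.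
  rewrite !rmorphM /= fmorphV /= !sJ.
  have := laplacian_mx_balance i j; rewrite !ss => E.
  apply: (mulfI (s0 i)); apply: (mulIf (s0 j)).
  rewrite !mulrA divfK // E; set x := (X in _ * X = _).
  rewrite (_ : Num.conj_op _ = x) //.
  by field; rewrite s0.
have /hermitian_normalmx/orthomx_spectralP := hS.
set P := spectralmx S; set d := spectral_diag S => SE.
have uP : P \is unitarymx := spectral_unitarymx S.
have iP : P \in unitmx := unitarymx_unit uP.
exists (P *m D), d; split.
- by rewrite unitmx_mul iP.
- have uPD : P *m D \in unitmx by rewrite unitmx_mul iP.
  rewrite -[LHS](mulKmx uPD) -[in RHS]mulmxA; congr (_ *m _).
  have PS : P *m S = diag_mx d *m P by rewrite [in LHS]SE -mulmxA mulKVmx.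
  by rewrite -(mulmxA P D) -SD (mulmxA P S) PS mulmxA.
- move=> phi psi; rewrite inner_enum.
  have innerE (u v : 'cV[R[i]]_n) :
      \sum_i u i 0 * (v i 0)^* = (v^t* *m u) 0 0.
    by rewrite mxE; apply: eq_bigr => i _; rewrite !mxE mulrC.
  rewrite innerE -!mulmxA trmx_mul map_mxM -mulmxA.
  rewrite (mulmxA _ P) -(invmx_unitary uP) mulVmx // mul1mx -innerE.
  have DE (f : 'cV[R[i]]_n) i : (D *m f) i 0 = s i * f i 0.
    by rewrite mul_diag_mx !mxE.
  apply: eq_bigr => i _; rewrite !DE ss rmorphM /= sJ.
  ring.
Qed.


(** The diagonal entries of any diagonalization are the roots of the
    characteristic polynomial; they are real because those roots are
    nonnegative, so they are the sorted eigenvalues up to a permutation. *)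
Lemma spectrum_perm (d : 'rV[R[i]]_n) :
  char_poly (laplacian_mx G) = \prod_(i < n) ('X - (d 0 i)%:P) ->
  exists s : 'S_n, forall i, d 0 (s i) = (lambda G i.+1)%:C.
Proof.
rewrite laplacian_rootsE => charE.
have rootsE : perm_eq (laplacian_roots G) [seq d 0 i | i <- enum 'I_n].
  by apply: prod_XsubC_eq; rewrite charE big_map big_enum.
have d_real i : d 0 i = (complex.Re (d 0 i))%:C.
  have : d 0 i \in laplacian_roots G.
    by rewrite (perm_mem rootsE) map_f ?mem_enum.
  move/laplacian_roots_ge0; case: (d 0 i) => a b; rewrite lecE /=.
  by case/andP=> /eqP ->.
have : perm_eq (spectrum G) [tuple complex.Re (d 0 i) | i < n].
  by rewrite /spectrum perm_sort (perm_trans (perm_map _ rootsE)) // -map_comp.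
case/tuple_permP => s spectrumE; exists s => i.
rewrite d_real /lambda spectrumE /=.
by rewrite (nth_map i) ?nth_ord_enum ?size_enum_ord // !tnth_mktuple.
Qed.

(** The coordinates on an orthonormal eigenbasis listed by increasing
    eigenvalue: the energy is read through the Laplacian, which acts diagonally,
    and the rows of the diagonalizing isometry are permuted to sort the
    eigenvalues. *)
Lemma spectral_coordinates :
  exists2 Q : 'M[R[i]]_n, Q \in unitmx & forall phi,
    inner phi phi = \sum_(i < n) `|(Q *m vec phi) i 0| ^+ 2 /\
    dirichlet phi phi =
      \sum_(i < n) (lambda G i.+1)%:C * `|(Q *m vec phi) i 0| ^+ 2.
Proof.
have [Q [d [uQ LE innerE]]] := laplacian_diagonalization.
have [|s sE] := @spectrum_perm d.
  by rewrite LE char_poly_diagonalizable.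
exists (row_perm s Q); first by rewrite row_permE unitmx_mul unitmx_perm.
have permE f i : (row_perm s Q *m f) i 0 = (Q *m f) (s i) 0 :> R[i].
  by rewrite !mxE; apply: eq_bigr => j _; rewrite mxE.
move=> phi; split.
  rewrite innerE (reindex_inj (@perm_inj _ s)); apply: eq_bigr => i _.
  by rewrite permE normCK.
rewrite -inner_laplacian innerE (reindex_inj (@perm_inj _ s)).
apply: eq_bigr => i _; rewrite permE normCK mulrA; congr (_ * _).
have -> : vec (laplacian phi) = laplacian_mx G *m vec phi.
  by rewrite laplacian_mxE.
by rewrite LE -!mulmxA mulKVmx // mul_diag_mx mxE sE.
Qed.

Lemma lambda_ge0 k : 0 <= lambda G k.
Proof.
rewrite /lambda; have [lek|] := ltnP k.-1 (size (spectrum G)); last first.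
  by move=> ?; rewrite nth_default.
have := mem_nth 0 lek; rewrite mem_sort => /mapP[z /laplacian_roots_ge0 + ->].
by rewrite lecE => /andP[].
Qed.

Lemma lambda_le i j : (i <= j)%N -> (j < n)%N -> lambda G i.+1 <= lambda G j.+1.
Proof.
move=> ij jn; rewrite /lambda /=.
have szE : size (spectrum G) = n.
  by rewrite size_sort size_map size_laplacian_roots.
apply: (sorted_leq_nth le_trans le_refl) => //; rewrite ?inE ?szE //.
  exact: sort_le_sorted.
exact: leq_ltn_trans jn.
Qed.

End SpectralCoordinates.


(** * Pullback along a homomorphism *)

Section Comparison.
Variables (R : realType) (A : zmodClosed (angle R)) (G G' : mwgraph A).
Implicit Type p : graph_hom G G'.

Definition pullback (p : graph_hom G G') (phi : vertex G' -> R[i]) :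
  vertex G -> R[i] := phi \o homv p.

Lemma inner_pullback p phi :
  inner (pullback p phi) (pullback p phi) =
  \sum_v' (pushv p v')%:C * `|phi v'| ^+ 2.
Proof.
rewrite /inner (partition_big (homv p) predT) //=; apply: eq_bigr => v' _.
rewrite rmorph_sum mulr_suml; apply: eq_bigr => v /eqP <-.
by rewrite normCK mulrA.
Qed.

Lemma inner_normE (H : mwgraph A) (phi : vertex H -> R[i]) :
  inner phi phi = \sum_v (wv v)%:C * `|phi v| ^+ 2.
Proof. by apply: eq_bigr => v _; rewrite normCK mulrA. Qed.

Lemma inner_gt0 (H : mwgraph A) (phi : vertex H -> R[i]) :
  vec phi != 0 -> 0 < inner phi phi.
Proof.
case/matrix0Pn => i [j]; rewrite mxE => phi0; rewrite inner_normE.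
have term_ge0 v : 0 <= (wv v)%:C * `|phi v| ^+ 2.
  by rewrite mulr_ge0 ?exprn_ge0 // lecR ltW ?wv_gt0.
rewrite lt_def sumr_ge0 // andbT psumr_neq0 //; apply/hasP.
exists (enum_val i); rewrite ?mem_index_enum //=.
by rewrite mulr_gt0 ?exprn_gt0 ?normr_gt0 // ltcR wv_gt0.
Qed.

Definition edge_energy (H : mwgraph A) (phi : vertex H -> R[i]) e : R[i] :=
  `|phi (src e) - expi (alpha e) * phi (tgt e)| ^+ 2.

Lemma dirichletE (H : mwgraph A) (phi : vertex H -> R[i]) :
  dirichlet phi phi = 2^-1 * \sum_e (we e)%:C * edge_energy phi e.
Proof.
by congr (_ * _); apply: eq_bigr => e _; rewrite /edge_energy normCK mulrA.
Qed.

Lemma dirichlet_pullback p phi : (forall e, alpha e = alpha (home p e)) ->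
  dirichlet (pullback p phi) (pullback p phi) =
  2^-1 * \sum_e' (pushe p e')%:C * edge_energy phi e'.
Proof.
move=> alphaE; rewrite dirichletE; congr (_ * _).
rewrite (partition_big (home p) predT) //=; apply: eq_bigr => e' _.
rewrite rmorph_sum mulr_suml; apply: eq_bigr => e /eqP <-.
by rewrite /edge_energy /pullback /= hom_src hom_tgt alphaE.
Qed.

Lemma inner_pullback_ge p phi : (forall v', wv v' <= pushv p v') ->
  inner phi phi <= inner (pullback p phi) (pullback p phi).
Proof.
move=> le_w; rewrite inner_normE inner_pullback; apply: ler_sum => v' _.
by rewrite ler_wpM2r ?exprn_ge0 // lecR.
Qed.

Lemma dirichlet_pullback_le p phi : (forall e, alpha e = alpha (home p e)) ->
  (forall e', pushe p e' <= we e') ->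
  dirichlet (pullback p phi) (pullback p phi) <= dirichlet phi phi.
Proof.
move=> alphaE le_w; rewrite dirichlet_pullback // dirichletE.
rewrite ler_wpM2l ?invr_ge0 ?ler0n //; apply: ler_sum => e' _.
by rewrite ler_wpM2r ?exprn_ge0 // lecR.
Qed.

(** * Comparison of the eigenvalues *)

Lemma vec_pullback p :
  {J : 'M[R[i]]_(#|vertex G|, #|vertex G'|) |
    forall phi, vec (pullback p phi) = J *m vec phi}.
Proof.
exists (\matrix_(i, j) (enum_rank (homv p (enum_val i)) == j)%:R) => phi.
apply/colP => i; rewrite !mxE (bigD1 (enum_rank (homv p (enum_val i)))) //=.
rewrite !mxE eqxx mul1r enum_rankK big1 ?addr0 // => j.
by rewrite mxE eq_sym => /negPf ->; rewrite mul0r.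
Qed.

(** What a combination of eigenfunctions of [H] with indices in [S] satisfies.
    Recording only these bounds on the Rayleigh quotient frees later arguments
    from any choice of eigenbasis. *)
Definition in_window (H : mwgraph A) (S : pred 'I_#|vertex H|)
    (phi : vertex H -> R[i]) : Prop :=
  (forall a : R, (forall i, S i -> lambda H i.+1 <= a) ->
     dirichlet phi phi <= a%:C * inner phi phi) /\
  (forall a : R, (forall i, S i -> a <= lambda H i.+1) ->
     a%:C * inner phi phi <= dirichlet phi phi).

(** Let [c] be the spectral coordinates of the function sought.  Vanishing of
    [c] off [S'] leaves [#|S'|] unknowns, and vanishing of the spectral
    coordinates of its pullback off [S] imposes [#|predC S|] linear equations on
    them. *)
Lemma exists_in_windows p
    (S' : pred 'I_#|vertex G'|) (S : pred 'I_#|vertex G|) :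
  (#|predC S| < #|S'|)%N ->
  exists phi : vertex G' -> R[i],
    [/\ 0 < inner phi phi, in_window S' phi & in_window S (pullback p phi)].
Proof.
move=> ltSS'; have [J JE] := vec_pullback p.
have [Q _ QE] := spectral_coordinates G.
have [Q' uQ' QE'] := spectral_coordinates G'.
have [c [c0 cS' cS]] := exists_supported_kernel (Q *m J *m invmx Q') ltSS'.
pose phi := unvec (invmx Q' *m c).
have vecE' : Q' *m vec phi = c by rewrite unvecK mulKVmx.
have vecE : Q *m vec (pullback p phi) = Q *m J *m invmx Q' *m c.
  by rewrite JE unvecK !mulmxA.
have windowP (H : mwgraph A) (W : pred 'I_#|vertex H|)
      (x : 'cV[R[i]]_#|vertex H|) (psi : vertex H -> R[i]) :
    inner psi psi = \sum_i `|x i 0| ^+ 2 ->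
    dirichlet psi psi =
      \sum_(i < #|vertex H|) (lambda H i.+1)%:C * `|x i 0| ^+ 2 ->
    (forall i, ~~ W i -> x i 0 = 0) -> in_window W psi.
  rewrite /in_window => -> -> x0.
  split=> a leWa; rewrite mulr_sumr; apply: ler_sum => i _;
    have [/leWa Wi|/x0->] := boolP (W i); rewrite ?normr0 ?expr0n ?mulr0 //;
    by rewrite ler_wpM2r ?exprn_ge0 // lecR.
have [N' E'] := QE' phi; have [N E] := QE (pullback p phi).
rewrite vecE' in N' E'; rewrite vecE in N E.
exists phi; split.
- apply: inner_gt0; apply: contraNneq c0 => phi0.
  by rewrite -vecE' phi0 mulmx0.
- exact: windowP N' E' cS'.
- exact: windowP N E cS.
Qed.

(** Vertex weights are positive, so every vertex of [G'] has a preimage. *)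
Lemma card_vertex_le p : (forall v', wv v' <= pushv p v') ->
  (#|vertex G'| <= #|vertex G|)%N.
Proof.
move=> le_wv.
have surj v' : exists v, homv p v == v'.
  apply/existsP; apply: contraTT (wv_gt0 v') => /existsPn no_v.
  rewrite -leNgt (le_trans (le_wv v')) // /pushv big_pred0 // => v.
  by have /negPf := no_v v.
have inj : injective (fun v' => xchoose (surj v')).
  move=> u v /(congr1 (homv p)).
  by rewrite (eqP (xchooseP (surj u))) (eqP (xchooseP (surj v))).
exact: leq_card inj.
Qed.

Lemma pullback_spectral_le p : mw_hom p -> spectral_le 0 G G'.
Proof.
move=> [alphaE le_wv le_we].
have energy_le phi : dirichlet (pullback p phi) (pullback p phi) <=
  dirichlet phi phi by exact: dirichlet_pullback_le.
have norm_ge phi : inner phi phi <= inner (pullback p phi) (pullback p phi).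
  exact: inner_pullback_ge.
have card_le := card_vertex_le le_wv.
split=> [|[//|k]]; rewrite subn0 // addn0 => /= km.
(* Indices are shifted by one: index [i] carries the eigenvalue numbered
   [i.+1], so the two index sets overlap exactly in [k]. *)
have [|phi [N0 [low _] [_ high]]] := @exists_in_windows p
    [pred i : 'I_ _ | i < k.+1]%N [pred i : 'I_ _ | k <= i]%N.
  rewrite [X in (_ < X)%N]card_ord_lt // ltnS.
  rewrite -(leq_add2l #|[pred i : 'I_#|vertex G| | k <= i]%N|) cardC card_ord.
  by rewrite card_ord_ge subnK // (leq_trans (ltnW km)).
rewrite -lecR -(ler_pM2r N0).
apply: le_trans _ (low _ (fun i ik => @lambda_le _ _ _ i k ik km)).
apply: le_trans _ (energy_le phi).
apply: le_trans _ (high _ (fun i ki => lambda_le ki (ltn_ord i))).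
(* The pullback may have a larger norm: this is where the sign of the
   eigenvalue matters. *)
by rewrite ler_wpM2l // lecR lambda_ge0.
Qed.

(** Pullback is now an isometry preserving the energy, so it embeds the
    quadratic form of [G'] as a restriction of that of [G]: this is Cauchy
    interlacing. *)
Lemma measure_preserving_spectral_ge p : mw_hom p ->
  vertex_measure_preserving p -> edge_measure_preserving p ->
  spectral_le (#|vertex G| - #|vertex G'|)%N G' G.
Proof.
move=> [alphaE le_wv _] mpv mpe; have card_le := card_vertex_le le_wv.
have energyE phi : dirichlet (pullback p phi) (pullback p phi) =
    dirichlet phi phi.
  rewrite dirichlet_pullback // dirichletE; congr (_ * _).
  by apply: eq_bigr => e' _; rewrite mpe.
have normE phi : inner (pullback p phi) (pullback p phi) = inner phi phi.
  by rewrite inner_pullback inner_normE; apply: eq_bigr => v' _; rewrite mpv.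
split=> [|[//|k]]; rewrite subKn // => /= km.
set r := (_ - _)%N; have krn : (k + r < #|vertex G|)%N.
  by rewrite -(subnKC card_le) ltn_add2r.
(* [|G'| - k] unknowns against the [|G| - (k + r + 1) = |G'| - k - 1]
   equations saying that the coordinates above [k + r] vanish. *)
have [|phi [N0 [_ high] [low _]]] := @exists_in_windows p
    [pred i : 'I_ _ | k <= i]%N [pred i : 'I_ _ | i < (k + r).+1]%N.
  rewrite card_ord_ge.
  rewrite -(ltn_add2l #|[pred i : 'I_#|vertex G| | i < (k + r).+1]%N|) cardC.
  rewrite card_ord card_ord_lt // addSn addnC addnA subnK ?(ltnW km) //.
  by rewrite subnKC.
rewrite -lecR -(ler_pM2r N0).
apply: le_trans (high _ (fun i ki => lambda_le ki (ltn_ord i))) _.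
rewrite -energyE -[X in _ <= _ * X]normE.
by apply: low => i ik; apply: lambda_le.
Qed.

End Comparison.

Theorem theorem3p14 (R : realType) (A : zmodClosed (angle R))
    (G G' : mwgraph A) :
  (mw_le G G' -> spectral_le 0 G G') /\
  ((exists p : graph_hom G G',
      [/\ mw_hom p, vertex_measure_preserving p & edge_measure_preserving p]) ->
   (#|vertex G'| <= #|vertex G|)%N /\
   spectral_le (#|vertex G| - #|vertex G'|)%N G' G).
Proof.
split=> [[p]|[p [hom_p mpv mpe]]]; first exact: pullback_spectral_le.
split; last exact: measure_preserving_spectral_ge hom_p mpv mpe.
by case: hom_p => _ /card_vertex_le.
Qed.
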